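(* Let $j\ge 2$ be an integer, let $\alpha=(\ldots,2,2;j,j,\ldots)$, let $S=\{0,1,\dots,j-1\}$, $Z=\{a_0,b_1\}$, and let $\tau\colon S\to Z$ be a surjective map. Then the bilateral adding machine map $f_\alpha\colon\Delta_\alpha\to\Delta_\alpha$ is a homeomorphism.
   Context: The symbols $a_0,b_1$ are identified with $0,1$ respectively (so $a_0+1=b_1$ and $b_1+1=a_0$ mod 2). A surjective map $\tau\colon S\to Z$ is called a transition map. Space: $\Delta_\alpha=\Sigma_{Z,S}$ is the set of all bi-infinite sequences $x=(\ldots,x_{-2},x_{-1};x_0,x_1,\ldots)$ with $x_i\in S$ for $i\ge 0$ and $x_i\in Z$ for $i<0$ (the image of $S^{\mathbb{Z}}$ under applying $\tau$ to all negative coordinates). It carries the metric $d(x,x)=0$ and $d(x,y)=2^{-M(x,y)}$ for $x\neq y$, where $M(x,y)=\min\{|i| : x_i\ne y_i,\ i\in\mathbb{Z}\}$; the induced topology is the product topology. Addition: for $x,y\in\Delta_\alpha$, $z=x+y$ is defined as follows. Nonnegative side: put $t_0=0$ and, for $i\ge 0$, $z_i=(x_i+y_i+t_i)\bmod j$, where $t_{i+1}=1$ if $x_i+y_i+t_i\ge j$ and $t_{i+1}=0$ otherwise. Negative side: put $s_1=\tau((x_0+y_0)\bmod j)$ and, for $i\ge 1$, $z_{-i}=(x_{-i}+y_{-i}+s_i)\bmod 2$, where $s_{i+1}=b_1=1$ if $x_{-i}+y_{-i}+s_i\ge 2$ and $s_{i+1}=a_0=0$ otherwise. Map: $f_\alpha(x)=x+(\ldots,a_0,a_0;1,0,0,0,\ldots)$.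 *)

(* Defs.v *)
From HB Require Import structures.
From mathcomp Require Import all_boot all_order all_algebra.
From mathcomp Require Import all_classical all_reals all_analysis.

Set Implicit Arguments.
Unset Strict Implicit.
Unset Printing Implicit Defensive.

Import Order.TTheory GRing.Theory Num.Theory.

Local Open Scope classical_set_scope.
Local Open Scope ring_scope.

(* alpha = (..., 2, 2; j, j, ...).  The digit alphabets are S = 'I_j and
   Z = 'I_2, the symbols a_0 and b_1 being the elements 0 and 1 of 'I_2. *)
Definition alpha (j : nat) (i : int) : nat :=
  match i with Posz _ => j | Negz _ => 2%N end.

(* Coordinate -n with n >= 1 is Negz n.-1.  The field R only serves to house
   the values of the distance. *)
Definition Delta (R : realType) (j : nat) : Type :=
  forall i : int, 'I_(alpha j i).

HB.instance Definition _ (R : realType) (j : nat) := gen_eqMixin (Delta R j).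
HB.instance Definition _ (R : realType) (j : nat) :=
  gen_choiceMixin (Delta R j).

Section distance.
Variables (R : realType) (j : nat).
Implicit Types x y z : Delta R j.

Definition differ x y (n : nat) : bool :=
  `[< exists i : int, `|i|%N = n /\ x i != y i >].

Lemma differ_ex x y : x <> y -> exists n, differ x y n.
Proof.
move=> xy; apply: contrapT => nd; apply: xy; apply: functional_extensionality_dep => i.
apply/eqP; apply: contrapT => /negP xyi; apply: nd.
by exists `|i|%N; apply/asboolP; exists i.
Qed.

Definition min_differ x y (xy : x <> y) : nat := ex_minn (differ_ex xy).

Definition delta_dist x y : R :=
  match pselect (x = y) with
  | left _ => 0
  | right xy => 2 ^- min_differ xy
  end.

Lemma delta_distxx x : delta_dist x x = 0.
Proof. by rewrite /delta_dist; case: pselect. Qed.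

Lemma delta_dist_ge0 x y : 0 <= delta_dist x y.
Proof.
by rewrite /delta_dist; case: pselect => // xy; rewrite invr_ge0 exprn_ge0.
Qed.

Lemma delta_dist_positivity x y : delta_dist x y = 0 -> x = y.
Proof.
rewrite /delta_dist; case: pselect => // xy /eqP.
by rewrite invr_eq0 expf_eq0 pnatr_eq0 andbF.
Qed.

Lemma delta_dist_ge x y (i : int) :
  x i != y i -> 2 ^- `|i|%N <= delta_dist x y.
Proof.
move=> xyi; rewrite /delta_dist; case: pselect => [xy|xy].
  by rewrite xy eqxx in xyi.
rewrite lef_pV2 ?posrE ?exprn_gt0// ler_eXn2l ?ltr1n//.
rewrite /min_differ; case: ex_minnP => m _; apply.
by apply/asboolP; exists i.
Qed.

Lemma delta_dist_sym_le x y : delta_dist x y <= delta_dist y x.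
Proof.
rewrite {1}/delta_dist; case: pselect => [_|xy]; first exact: delta_dist_ge0.
rewrite /min_differ; case: ex_minnP => m /asboolP[i [<- xyi]] _.
by apply: delta_dist_ge; rewrite eq_sym.
Qed.

Lemma delta_dist_sym x y : delta_dist x y = delta_dist y x.
Proof. by apply/eqP; rewrite eq_le !delta_dist_sym_le. Qed.

Lemma delta_dist_triangle y x z :
  delta_dist x z <= delta_dist x y + delta_dist y z.
Proof.
rewrite {1}/delta_dist; case: pselect => [_|xz].
  by rewrite addr_ge0 ?delta_dist_ge0.
rewrite /min_differ; case: ex_minnP => m /asboolP[i [<- xzi]] _.
have [xyi|/delta_dist_ge xyi] := eqVneq (x i) (y i).
  by rewrite ler_wpDl ?delta_dist_ge0// delta_dist_ge// -xyi.
by rewrite ler_wpDr ?delta_dist_ge0.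
Qed.

HB.instance Definition _ := @isMetric.Build R (Delta R j) delta_dist
  delta_distxx delta_dist_positivity delta_dist_sym delta_dist_triangle.

End distance.

(* m mod n as a digit; the first argument only witnesses 0 < n. *)
Definition digit_mod (n : nat) (a : 'I_n) (m : nat) : 'I_n :=
  Ordinal (ltn_pmod m (leq_ltn_trans (leq0n a) (ltn_ord a))).

Section addition.
Variables (R : realType) (j : nat) (tau : 'I_j -> 'I_2).
Implicit Types x y : Delta R j.

(* t_n *)
Fixpoint pos_carry x y (n : nat) : nat :=
  match n with
  | 0%N => 0%N
  | n'.+1 => (j <= x (Posz n') + y (Posz n') + pos_carry x y n')%N : nat
  end.

(* s_(n+1), the carry entering coordinate -(n+1) = Negz n *)
Fixpoint neg_carry x y (n : nat) : nat :=
  match n with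
  | 0%N => tau (digit_mod (x (Posz 0)) (x (Posz 0) + y (Posz 0))%N)
  | n'.+1 => (2 <= x (Negz n') + y (Negz n') + neg_carry x y n')%N : nat
  end.

Definition delta_add x y : Delta R j := fun i =>
  match i return 'I_(alpha j i) with
  | Posz n => digit_mod (x (Posz n))
                (x (Posz n) + y (Posz n) + pos_carry x y n)%N
  | Negz n => digit_mod (x (Negz n))
                (x (Negz n) + y (Negz n) + neg_carry x y n)%N
  end.

End addition.

(* (..., a_0, a_0; 1, 0, 0, ...) *)
Definition delta_one (R : realType) (j : nat) (hj : (2 <= j)%N) : Delta R j :=
  fun i => match i return 'I_(alpha j i) with
  | Posz 0%N => Ordinal hj
  | Posz _.+1 => Ordinal (ltnW hj)
  | Negz _ => ord0
  end.

Definition f_alpha (R : realType) (j : nat) (hj : (2 <= j)%N)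
    (tau : 'I_j -> 'I_2) (x : Delta R j) : Delta R j :=
  delta_add tau x (delta_one R hj).

Definition homeomorphism (T U : topologicalType) (f : T -> U) : Prop :=
  continuous f /\
  exists g : U -> T, [/\ cancel f g, cancel g f & continuous g].

(* Main.v *)
Require Import Defs.
From mathcomp Require Import all_boot all_order all_algebra.
From mathcomp Require Import all_classical all_reals all_analysis.
From mathcomp Require Import zify.

Set Implicit Arguments.
Unset Strict Implicit.
Unset Printing Implicit Defensive.

Local Open Scope classical_set_scope.

(** Adding the unit sequence runs an odometer with initial carry 1 on the
    nonnegative side, and an odometer with initial carry [tau (z 0)] on the
    negative side, [z] being the result.  As that initial carry can be read off
    the result, both odometers are inverted digit by digit, with borrows in place
    of carries.  In both directions, the coordinate of index [i] of the result
    depends only on the coordinates of index at most [|i|] in absolute value, so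
    the map and its inverse are nonexpansive for the metric. *)

Section odometer.
Variable n : nat.
Implicit Types (u w : nat -> 'I_n) (a : 'I_n) (c k : nat).

Fixpoint carry c u k : nat :=
  if k is k'.+1 then (n <= u k' + carry c u k')%N else c.

Fixpoint borrow c w k : nat :=
  if k is k'.+1 then (w k' < borrow c w k')%N else c.

Definition add_carry c u k : 'I_n := digit_mod (u k) (u k + carry c u k).

(** Adding [n - b] subtracts [b] modulo [n] without truncation: a borrow is at most 1 when [c] is,
    and [n] is positive since digits exist. *)
Definition sub_borrow c w k : 'I_n :=
  digit_mod (w k) (w k + (n - borrow c w k)).

Lemma carry_le1 c u k : (c <= 1)%N -> (carry c u k <= 1)%N.
Proof. by case: k => //= k _; exact: leq_b1. Qed.

Lemma borrow_le1 c w k : (c <= 1)%N -> (borrow c w k <= 1)%N.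
Proof. by case: k => //= k _; exact: leq_b1. Qed.

(** An overflow forces [c = 1] and [a + c = n], so the new digit is 0; without overflow it is
    [a + c], at least [c]. Hence the new digit reveals the outgoing carry. *)
Lemma digit_add_carry a c : (c <= 1)%N -> ((a + c) %% n < c)%N = (n <= a + c)%N.
Proof.
move=> c1; have an := ltn_ord a; have [nac|acn] := leqP n (a + c).
  have -> : (a + c)%N = n by lia.
  by rewrite modnn; apply/idP; lia.
by rewrite modn_small// ltnNge leq_addl.
Qed.

Lemma digit_addK a c : (c <= 1)%N -> ((a + c) %% n + (n - c)) %% n = a.
Proof.
move=> c1; have an := ltn_ord a.
rewrite modnDml (_ : _ + _ = a + n)%N; last by lia.
by rewrite modnDr modn_small.
Qed.

Lemma digit_subK a c : (c <= 1)%N -> ((a + (n - c)) %% n + c) %% n = a.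
Proof.
move=> c1; have an := ltn_ord a.
rewrite modnDml (_ : _ + _ = a + n)%N; last by lia.
by rewrite modnDr modn_small.
Qed.

Lemma borrow_add_carry c u k : (c <= 1)%N ->
  borrow c (add_carry c u) k = carry c u k.
Proof.
by move=> c1; elim: k => //= k ->; rewrite digit_add_carry ?carry_le1.
Qed.

Lemma carry_sub_borrow c w k : (c <= 1)%N ->
  carry c (sub_borrow c w) k = borrow c w k.
Proof.
move=> c1; elim: k => //= k ->.
(* An overflow when the borrow is added back shows in the resulting digit, which is [w k]. *)
by rewrite -(digit_add_carry (sub_borrow c w k)) ?borrow_le1//= digit_subK
  ?borrow_le1.
Qed.

Lemma add_carryK c u k : (c <= 1)%N -> sub_borrow c (add_carry c u) k = u k.
Proof.
move=> c1; apply: val_inj.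
by rewrite /= borrow_add_carry// digit_addK// carry_le1.
Qed.

Lemma sub_borrowK c w k : (c <= 1)%N -> add_carry c (sub_borrow c w) k = w k.
Proof.
move=> c1; apply: val_inj.
by rewrite /= carry_sub_borrow// digit_subK// borrow_le1.
Qed.

Lemma eq_add_carry c u w k : (forall i, (i <= k)%N -> u i = w i) ->
  add_carry c u k = add_carry c w k.
Proof.
move=> uw; apply: val_inj; rewrite /= uw//; congr ((_ + _) %% _).
elim: k uw => //= k IH uw; rewrite uw ?leqnSn// IH// => i ik.
by rewrite uw// ltnW.
Qed.

Lemma eq_sub_borrow c u w k : (forall i, (i <= k)%N -> u i = w i) ->
  sub_borrow c u k = sub_borrow c w k.
Proof.
move=> uw; apply: val_inj; rewrite /= uw//; congr ((_ + (_ - _)) %% _).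
elim: k uw => //= k IH uw; rewrite uw ?leqnSn// IH// => i ik.
by rewrite uw// ltnW.
Qed.

End odometer.

Section adding_machine.
Variables (R : realType) (j : nat) (hj : (2 <= j)%N) (tau : 'I_j -> 'I_2).
Implicit Types (x y z : Delta R j) (h : Delta R j -> Delta R j).

Lemma continuous_causal h :
  (forall x y i, (forall k : int, (`|k| <= `|i|)%N -> x k = y k) ->
    h x i = h y i) ->
  continuous h.
Proof.
move=> hP.
have h_le x y : (delta_dist (h x) (h y) <= delta_dist x y)%R.
  rewrite {1}/delta_dist; case: pselect => [_|hxy]; first exact: delta_dist_ge0.
  rewrite /min_differ; case: ex_minnP => m /asboolP[i [<- hxyi]] _.
  (* Here [i] is a differing coordinate of the images with least absolute value; by causality the
     inputs already differ no farther from the centre. *)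
  have [k ki xyk] : exists2 k : int, (`|k| <= `|i|)%N & x k != y k.
    apply: contrapT => nk; move/eqP: hxyi; apply; apply: hP => k ki.
    by apply/eqP; apply: contrapT => /negP xyk; apply: nk; exists k.
  apply: Order.POrderTheory.le_trans (delta_dist_ge xyk).
  rewrite Num.Theory.lef_pV2 ?Num.Theory.posrE ?Num.Theory.exprn_gt0//.
  by rewrite Num.Theory.ler_eXn2l ?Num.Theory.ltr1n.
move=> x; apply/(@cvg_ballP _ _ _ _ (nbhs_filter x)) => e e0.
apply: filterS (nbhsx_ballx x e e0) => y.
by rewrite !ballEmdist; apply: Order.POrderTheory.le_lt_trans; exact: h_le.
Qed.

Definition pos_part x (k : nat) : 'I_j := x (Posz k).
Definition neg_part x (k : nat) : 'I_2 := x (Negz k).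

Definition f_alpha_inv z : Delta R j := fun i =>
  match i return 'I_(alpha j i) with
  | Posz k => sub_borrow 1 (pos_part z) k
  | Negz k => sub_borrow (tau (pos_part z 0)) (neg_part z) k
  end.

(** The digit 1 of the unit acts as an initial carry: at each [k], the unit's digit plus [t_k]
    equals [carry 1 (pos_part x) k]. *)
Lemma pos_part_f x : pos_part (f_alpha hj tau x) = add_carry 1 (pos_part x).
Proof.
apply: funext => k; apply: val_inj => /=; rewrite -addnA; congr ((_ + _) %% _).
case: k => //= k; rewrite add0n -addnA; congr (nat_of_bool (_ <= _ + _)%N).
by elim: k => //= k <-; rewrite add0n -addnA.
Qed.

Lemma neg_part_f x :
  neg_part (f_alpha hj tau x) =
  add_carry (tau (pos_part (f_alpha hj tau x) 0)) (neg_part x).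
Proof.
apply: funext => k; apply: val_inj => /=; rewrite addn0; congr ((_ + _) %% _).
elim: k => [|k /= ->]; last by rewrite addn0.
(* Since [t_0 = 0], the argument of [tau] in [s_1] is the image's digit at 0. *)
by congr (nat_of_ord (tau _)); apply: val_inj; rewrite /= addn0.
Qed.

Lemma Delta_eq x y : pos_part x = pos_part y -> neg_part x = neg_part y -> x = y.
Proof.
move=> xyp xyn; apply: functional_extensionality_dep => -[k|k].
  exact: (congr1 (@^~ k) xyp).
exact: (congr1 (@^~ k) xyn).
Qed.

Lemma ord2_le1 (b : 'I_2) : (b <= 1)%N. Proof. by rewrite -ltnS. Qed.

Lemma f_alphaK : cancel (f_alpha hj tau) f_alpha_inv.
Proof.
move=> x; apply: Delta_eq; apply: funext => k.
  by rewrite {1}/pos_part /= pos_part_f add_carryK.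
by rewrite {1}/neg_part /= neg_part_f add_carryK ?ord2_le1.
Qed.

Lemma f_alpha_invK : cancel f_alpha_inv (f_alpha hj tau).
Proof.
(* The nonnegative side comes first: its digit at 0 makes the initial carry of the negative side
   match the borrow. *)
have posK z : pos_part (f_alpha hj tau (f_alpha_inv z)) = pos_part z.
  by rewrite pos_part_f; apply: funext => k; rewrite sub_borrowK.
move=> z; apply: Delta_eq => //; rewrite neg_part_f posK.
by apply: funext => k; rewrite sub_borrowK ?ord2_le1.
Qed.

Lemma continuous_f_alpha_inv : continuous f_alpha_inv.
Proof.
apply: continuous_causal => x y [k|k] xy /=.
  by apply: eq_sub_borrow => i ik; exact: (xy (Posz i)).
rewrite /pos_part (xy (Posz 0))//.
by apply: eq_sub_borrow => i ik; exact: (xy (Negz i)).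
Qed.

Lemma continuous_f_alpha : continuous (f_alpha hj tau : Delta R j -> Delta R j).
Proof.
apply: continuous_causal => x y i xy.
(* Also used at [k = 0] when [i] is negative, to equate the initial carries. *)
have pos_eq k : (k <= `|i|)%N ->
    pos_part (f_alpha hj tau x) k = pos_part (f_alpha hj tau y) k.
  move=> ki; rewrite !pos_part_f; apply: eq_add_carry => l lk.
  exact/(xy (Posz l))/(leq_trans lk).
case: i xy pos_eq => k xy pos_eq; first exact: pos_eq.
rewrite -!/(neg_part _ _) !neg_part_f pos_eq//.
by apply: eq_add_carry => l lk; exact: (xy (Negz l)).
Qed.

End adding_machine.

Theorem proposition2p11 (R : realType) (j : nat) (hj : (2 <= j)%N)
    (tau : 'I_j -> 'I_2) (htau : set_surj [set: 'I_j] [set: 'I_2] tau) :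
  homeomorphism (@f_alpha R j hj tau : Delta R j -> Delta R j).
Proof.
split; first exact: continuous_f_alpha.
exists (f_alpha_inv tau); split.
- exact: f_alphaK.
- exact: f_alpha_invK.
- exact: continuous_f_alpha_inv.
Qed.
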